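(* Let $\overline C_1,\overline C_2,\overline C_3>0$ be the constants (independent of $h$) of the three estimates listed in the context, and assume that $$\overline C_1\overline C_3\max_{e\in\mathcal E_h^\partial}\{r_e^2,r_e(C^e_{ext})^2\}<\tfrac12,\qquad\overline C_2L(Lh^2+2\overline C_1)<\tfrac12,\qquad(2\overline C_2+1)\overline C_3\max_{e\in\mathcal E_h^\partial}\{r_e^2,r_e(C^e_{ext})^2\}<\tfrac12.$$ Then there exists a positive constant $C_{rel}$, independent of $h$, such that $$\mathrm e_h^2\le C_{rel}\left(\eta^2+\mathrm{osc}^2(\mathcal F,\mathcal T_h)\right),$$ where $\mathrm e_h^2=\|\kappa^{-1/2}(\boldsymbol q-\boldsymbol q_h)\|_{\Omega_h}^2+\|u-u_h^*\|_{\Omega_h}^2+\|h_e^{-1/2}(\varphi-\varphi_h)\|_{\Gamma_h}^2$.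
   Context: Domain and data. $d\in\{2,3\}$; $\Omega\subset\mathbb R^d$ is a domain with piecewise smooth, not necessarily polygonal/polyhedral, boundary $\Gamma$; $\kappa$ is a function on $\Omega$ with $0<\underline\kappa\le\kappa\le\overline\kappa$; $g$ is Dirichlet data on $\Gamma$; $\mathcal F$ is a source term depending on the solution, Lipschitz on $L^2(\Omega)$ with constant $L_\Omega$. The exact solution $(\boldsymbol q,u)$ satisfies $\boldsymbol q+\kappa\nabla u=0$, $\nabla\cdot\boldsymbol q=\mathcal F(u)$ in $\Omega$, $u=g$ on $\Gamma$. $\Omega_h\subset\Omega$ is a polygonal/polyhedral subdomain with boundary $\Gamma_h$; $L\le L_\Omega$ is the Lipschitz constant of $\mathcal F$ in $\Omega_h$ (in the $L^2$ norm); $\varphi=u|_{\Gamma_h}$. Mesh. $\{\mathcal T_h\}$ is a shape-regular family of simplicial triangulations of $\Omega_h$, $h_T=\mathrm{diam}\,T$, $h=\max_Th_T<1$; $\mathcal E_h=\mathcal E_h^\circ\cup\mathcal E_h^\partial$ are the faces (interior, boundary); $h_e$ is the length of $e$; $\boldsymbol n$ is the outward unit normal. For $e\in\mathcal E_h^\partial$, $T^e$ is the element having $e$ as a face. To each $\boldsymbol x\in e$ a point $\overline{\boldsymbol x}\in\Gamma$ is associated; $l(\boldsymbol x)=|\boldsymbol x-\overline{\boldsymbol x}|$, $\boldsymbol t(\boldsymbol x)$ is the unit vector from $\boldsymbol x$ to $\overline{\boldsymbol x}$, and $T^e_{ext}=\{\boldsymbol x+s\boldsymbol t:0\le s\le l(\boldsymbol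 x),\boldsymbol x\in e\}$. The transfer segments do not intersect each other inside a patch nor the interior of $\Omega_h$, and the patches cover $\Omega\setminus\overline{\Omega_h}$. $h_e^\perp$ (resp. $H_e^\perp$) is the largest distance of a point of $T^e$ (resp. $T^e_{ext}$) to the plane of $e$; $r_e=H_e^\perp/h_e^\perp$. Polynomials on $T^e$ are extended to $T^e_{ext}$ by the same polynomial expression. With $\mathcal V^k=\{\boldsymbol p\in[\mathbb P_k(T^e_{ext}\cup T^e)]^d:\boldsymbol p\cdot\boldsymbol n_e\ne0\}$, where $\boldsymbol n_e$ is the constant vector field equal to the normal to $e$ exterior to $T^e$, set $C^e_{ext}=r_e^{-1/2}\sup_{\boldsymbol\chi\in\mathcal V^k}\|\boldsymbol\chi\cdot\boldsymbol n_e\|_{T^e_{ext}}/\|\boldsymbol\chi\cdot\boldsymbol n_e\|_{T^e}$ and $C^e_{inv}=h_e^\perp\sup_{\boldsymbol\chi\in\mathcal V^k}\|\nabla\boldsymbol\chi\cdot\boldsymbol n_e\|_{T^e}/\|\boldsymbol\chi\cdot\boldsymbol n_e\|_{T^e}$. HDG scheme. $k\ge1$; $\boldsymbol V_h$, $W_h$, $M_h$ are the spaces of functions that are $[\mathbb P_k(T)]^d$, $\mathbb P_k(T)$ on each element and $\mathbb P_k(e)$ on each face, respectively; $W_h^*$ is the space of elementwise $\mathbb P_{k+1}(T)$ functions. $\tau>0$ is a stabilization function on $\partial\mathcal T_h$ with maximum $\overline\tau$. $(\boldsymbol q_h,u_h,\widehat u_h)\in\boldsymbol V_h\times W_h\times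 M_h$ satisfies, for all $(\boldsymbol v,w,\mu)\in\boldsymbol V_h\times W_h\times M_h$, $(\kappa^{-1}\boldsymbol q_h,\boldsymbol v)_{\mathcal T_h}-(u_h,\nabla\cdot\boldsymbol v)_{\mathcal T_h}+\langle\widehat u_h,\boldsymbol v\cdot\boldsymbol n\rangle_{\partial\mathcal T_h}=0$, $-(\boldsymbol q_h,\nabla w)_{\mathcal T_h}+\langle\widehat{\boldsymbol q}_h\cdot\boldsymbol n,w\rangle_{\partial\mathcal T_h}=(\mathcal F(u_h),w)_{\mathcal T_h}$, $\langle\widehat u_h,\mu\rangle_{\Gamma_h}=\langle\varphi_h,\mu\rangle_{\Gamma_h}$, $\langle\widehat{\boldsymbol q}_h\cdot\boldsymbol n,\mu\rangle_{\partial\mathcal T_h\setminus\Gamma_h}=0$, with $\widehat{\boldsymbol q}_h\cdot\boldsymbol n=\boldsymbol q_h\cdot\boldsymbol n+\tau(u_h-\widehat u_h)$ and $\varphi_h(\boldsymbol x)=g(\overline{\boldsymbol x})+\int_0^{l(\boldsymbol x)}(\kappa^{-1}\boldsymbol q_h)(\boldsymbol x+\boldsymbol ts)\cdot\boldsymbol t\,ds$ on $\Gamma_h$. Post-processing. $u_h^*\in W_h^*$ satisfies on each $T$: $(\kappa\nabla u_h^*,\nabla w)_T+(\mathcal F(u_h^* ),w)_T=-(\boldsymbol q_h,\nabla w)_T+(\mathcal F(u_h),w)_T$ for all $w\in\mathbb P_{k+1}(T)$, and $(u_h^*,w)_T=(u_h,w)_T$ for all $w\in\mathbb P_0(T)$.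 Standing assumptions. For every $e\in\mathcal E_h^\partial$: $\boldsymbol t=\boldsymbol n$ on $e$; $r_e\le C$; $\overline\tau H_e^\perp\underline\kappa^{-1}\le1/3$; $\overline\kappa\,\underline\kappa^{-1}r_e^3(C^e_{ext}C^e_{inv})^2\le1$. For every $\Theta\in L^2(\Omega)$ the solution of $\kappa^{-1}\boldsymbol\phi+\nabla\psi=0$, $\nabla\cdot\boldsymbol\phi=\Theta$ in $\Omega$, $\psi=0$ on $\partial\Omega$, satisfies $\|\boldsymbol\phi\|_{H^1(\Omega)}+\|\psi\|_{H^2(\Omega)}\le C_{reg}\|\Theta\|_\Omega$. $\varphi$ is the trace on $\Gamma_h$ of a function in $W_h^*\cap H^1(\Omega_h)$. Estimator. $P_W$ is the $L^2$ projection onto $W_h$. On interior faces $[\![w]\!]=w^+-w^-$ and $[\![\boldsymbol v]\!]=\boldsymbol v^+\cdot\boldsymbol n^++\boldsymbol v^-\cdot\boldsymbol n^-$. $\eta^2=\sum_{T\in\mathcal T_h}\eta_T^2$ with $\eta_T^2=h_T^2\|P_W\mathcal F(u_h^* )-\nabla\cdot\boldsymbol q_h\|_T^2+\|\kappa^{1/2}\nabla u_h^*+\kappa^{-1/2}\boldsymbol q_h\|_T^2+\sum_{e}\big(h_e\|[\![\boldsymbol q_h]\!]\|_e^2+h_e^{-1}\|[\![u_h^*]\!]\|_e^2\big)+\sum_{e'}h_{e'}^{-1}\|\varphi_h-u_h^*\|_{e'}^2$, where $e$ (resp. $e'$) runs over the interior (resp. boundary) faces of $T$. $\mathrm{osc}^2(\mathcal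 F,\mathcal T_h)=\sum_{T\in\mathcal T_h}h_T^2\|\mathcal F(u_h^* )-P_W\mathcal F(u_h^* )\|_T^2$. Constants $\overline C_1,\overline C_2,\overline C_3$. They are positive, independent of $h$, and such that: (1) $\|\kappa^{-1/2}(\boldsymbol q-\boldsymbol q_h)\|_{\Omega_h}^2\le\overline C_1\big(\mathrm{osc}^2(\mathcal F,\mathcal T_h)+\sum_Th_T^2\|P_W\mathcal F(u_h^* )-\nabla\cdot\boldsymbol q_h\|_T^2+\sum_T\|\kappa^{1/2}\nabla u_h^*+\kappa^{-1/2}\boldsymbol q_h\|_T^2+\sum_{e\in\mathcal E_h^\circ}(h_e\|[\![\boldsymbol q_h]\!]\|_e^2+h_e^{-1}\|[\![u_h^*]\!]\|_e^2)+\sum_{e\in\mathcal E_h^\partial}h_e^{-1}\|\varphi_h-u_h^*\|_e^2\big)+\overline C_1\|h_e^{-1/2}(\varphi-\varphi_h)\|_{\Gamma_h}^2+\overline C_1L\|u-u_h^*\|_{\Omega_h}^2$; (2) $\|u-u_h^*\|_{\Omega_h}^2\le\overline C_2\big(\sum_T\|\kappa^{-1/2}\boldsymbol q_h+\kappa^{1/2}\nabla u_h^*\|_T^2+\sum_{e\in\mathcal E_h^\circ}h_e^{-1}\|[\![u_h^*]\!]\|_e^2+\sum_{e\in\mathcal E_h^\partial}h_e^{-1}\|\varphi_h-u_h^*\|_e^2+\|\kappa^{-1/2}(\boldsymbol q-\boldsymbol q_h)\|_{\Omega_h}^2+\|h_e^{-1/2}(\varphi-\varphi_h)\|_{\Gamma_h}^2\big)$;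 (3) $\|h_e^{-1/2}(\varphi-\varphi_h)\|_{\Gamma_h}^2\le\overline C_3\max_{e\in\mathcal E_h^\partial}\{r_e^2,r_e(C^e_{ext})^2\}\big(\|\kappa^{-1/2}(\boldsymbol q-\boldsymbol q_h)\|_{\Omega_h}^2+h^2L^2\|u-u_h^*\|_{\Omega_h}^2+\sum_Th_T^2\|P_W\mathcal F(u_h^* )-\nabla\cdot\boldsymbol q_h\|_T^2+\mathrm{osc}^2(\mathcal F,\mathcal T_h)\big)$. $\|\cdot\|_D$ is the $L^2(D)$ norm; $(\cdot,\cdot)_{\mathcal T_h}$, $\langle\cdot,\cdot\rangle_{\partial\mathcal T_h}$ are sums of $L^2$ inner products over elements and element boundaries, and $\|\cdot\|_{\Gamma_h}$ is the facewise $L^2$ norm. *)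

(* Defs.v *)
From HB Require Import structures.
From mathcomp Require Import all_boot all_order all_algebra.
From mathcomp Require Import all_classical all_reals all_analysis.
From mathcomp Require mpoly.

Set Implicit Arguments.
Unset Strict Implicit.
Unset Printing Implicit Defensive.
Import Order.TTheory GRing.Theory Num.Theory.
Import numFieldNormedType.Exports.
Local Open Scope classical_set_scope.
Local Open Scope ring_scope.

Section euclid.
Context {R : realType} {d : nat}.
Implicit Types x y : 'rV[R]_d.

(* The norm of the library on ['rV[R]_d] is the sup norm; it is only used for
   the topology. *)
Definition dot x y : R := \sum_i x ord0 i * y ord0 i.
Definition enorm x : R := Num.sqrt (dot x x).
Definition ediam (A : set 'rV[R]_d) : R :=
  sup [set r | exists x y, [/\ A x, A y & r = enorm (x - y)]].
Definition bd (A : set 'rV[R]_d) : set 'rV[R]_d := closure A `\` A°.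
Definition is_domain (A : set 'rV[R]_d) : Prop :=
  [/\ open A, connected A & A !=set0].
End euclid.

(* Every set is measurable in [allsets T], so that [mu_ext rho] on [allsets T]
   is the infimum of [\sum_k rho (A k)] over all sequences of sets covering. *)
Definition allsets (T : pointedType) := g_sigma_algebraType [set: set T].

Section lebesgue.
Context (R : realType) (d : nat).
Local Open Scope ereal_scope.

(* [box_vol A] is the volume of the smallest closed box containing [A]. *)
Definition box_vol (A : set (allsets 'rV[R]_d)) : \bar R :=
  ereal_inf [set v | (A = set0 /\ v = 0) \/
    exists a b : 'rV[R]_d, [/\ forall i, (a ord0 i <= b ord0 i)%R,
      A `<=` [set x : 'rV[R]_d |
               forall i, (a ord0 i <= x ord0 i <= b ord0 i)%R] &
      v = (\prod_i (b ord0 i - a ord0 i))%R%:E]].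

Definition leb_outer : set 'rV[R]_d -> \bar R := mu_ext box_vol.

Lemma box_vol_ge0 A : 0 <= box_vol A.
Proof.
apply: le_ereal_inf_tmp => _ [[_ ->]//|[a [b [ab _ ->]]]].
by rewrite lee_fin; apply: prodr_ge0 => i _; rewrite subr_ge0.
Qed.

Lemma box_vol0 : box_vol set0 = 0.
Proof.
apply/eqP; rewrite eq_le box_vol_ge0 andbT.
by apply: ereal_inf_lbound; left.
Qed.

Lemma leb_outer0 : leb_outer set0 = 0.
Proof. exact: mu_ext0 box_vol0 box_vol_ge0. Qed.

Lemma leb_outer_ge0 A : 0 <= leb_outer A.
Proof. exact: mu_ext_ge0 box_vol_ge0 A. Qed.

Lemma le_leb_outer : {homo leb_outer : A B / A `<=` B >-> A <= B}.
Proof. exact: (@le_mu_ext _ _ _ box_vol). Qed.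

Lemma leb_outer_subadditive : sigma_subadditive leb_outer.
Proof. exact: mu_ext_sigma_subadditive box_vol_ge0. Qed.

HB.instance Definition _ := isOuterMeasure.Build R 'rV[R]_d leb_outer
  leb_outer0 leb_outer_ge0 le_leb_outer leb_outer_subadditive.

End lebesgue.

Section hausdorff.
Context (R : realType) (d : nat).
Local Open Scope ereal_scope.

Fixpoint ball_vol (s : nat) : R :=
  match s with
  | 0 => 1
  | 1 => 2
  | s'.+2 => 2 * pi / s'.+2%:R * ball_vol s'
  end%R.

Lemma ball_vol_ge0 s : (0 <= ball_vol s)%R.
Proof.
suff: (0 <= ball_vol s)%R /\ (0 <= ball_vol s.+1)%R by case.
elim: s => [|s [h1 h2]]; first by [].
by split => //=; rewrite mulr_ge0// divr_ge0// mulr_ge0// pi_ge0.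
Qed.

(* [diam_vol s delta A] is the volume of the [s]-dimensional ball with the same
   diameter as [A], or [+oo] if the diameter of [A] exceeds [delta]. *)
Definition diam_vol (s : nat) (delta : R) (A : set (allsets 'rV[R]_d)) :=
  ereal_inf [set v | (A = set0 /\ v = 0) \/
    exists r : R, [/\ (0 <= r <= delta)%R,
      forall x y : 'rV[R]_d, A x -> A y -> (enorm (x - y) <= r)%R &
      v = (ball_vol s * (r / 2) ^+ s)%R%:E]].

Lemma diam_vol_ge0 s delta A : 0 <= diam_vol s delta A.
Proof.
apply: le_ereal_inf_tmp => _ [[_ ->]//|[r [/andP[r0 _] _ ->]]].
by rewrite lee_fin mulr_ge0 ?ball_vol_ge0// exprn_ge0// divr_ge0.
Qed.

Lemma diam_vol0 s delta : diam_vol s delta set0 = 0.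
Proof.
apply/eqP; rewrite eq_le diam_vol_ge0 andbT.
by apply: ereal_inf_lbound; left.
Qed.

Definition hausdorff_outer (s : nat) (A : set 'rV[R]_d) : \bar R :=
  ereal_sup [set mu_ext (diam_vol s delta) A | delta in [set e : R | (0 < e)%R]].

Lemma hausdorff_outer_ge0 s A : 0 <= hausdorff_outer s A.
Proof.
apply: (le_trans (mu_ext_ge0 (diam_vol_ge0 s 1) A)).
by apply: ereal_sup_ubound; exists 1%R => //=.
Qed.

Lemma hausdorff_outer0 s : hausdorff_outer s set0 = 0.
Proof.
apply/eqP; rewrite eq_le hausdorff_outer_ge0 andbT.
apply: ge_ereal_sup => _ [e _ <-].
by rewrite (mu_ext0 (diam_vol0 s e) (diam_vol_ge0 s e)).
Qed.

Lemma le_hausdorff_outer s :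
  {homo hausdorff_outer s : A B / A `<=` B >-> A <= B}.
Proof.
move=> A B AB; apply: ge_ereal_sup => _ [e e0 <-].
apply: (le_trans (le_mu_ext (diam_vol s e) AB)).
by apply: ereal_sup_ubound; exists e.
Qed.

Lemma hausdorff_outer_subadditive s : sigma_subadditive (hausdorff_outer s).
Proof.
move=> F; apply: ge_ereal_sup => _ [e e0 <-].
apply: (le_trans (mu_ext_sigma_subadditive (diam_vol_ge0 s e) F)).
apply: lee_nneseries => [n _ _|n _]; first exact: (mu_ext_ge0 (diam_vol_ge0 s e) (F n)).
by apply: ereal_sup_ubound; exists e.
Qed.

HB.instance Definition _ s := isOuterMeasure.Build R 'rV[R]_d
  (hausdorff_outer s) (hausdorff_outer0 s) (hausdorff_outer_ge0 s)
  (@le_hausdorff_outer s) (@hausdorff_outer_subadditive s).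

End hausdorff.

Section sobolev.
Context (R : realType) (d : nat).
Local Notation E := 'rV[R]_d.

Definition vol : {outer_measure set E -> \bar R} := @leb_outer R d.
Definition sur : {outer_measure set E -> \bar R} := @hausdorff_outer R d d.-1.

Section L2.
Variable mu : {outer_measure set E -> \bar R}.

Definition eint (A : set E) (f : E -> R) : \bar R :=
  (\int[(mu : set (caratheodory_type mu) -> \bar R)]_(x in A) (f x)%:E)%E.
Definition integ (A : set E) (f : E -> R) : R :=
  Rintegral (mu : set (caratheodory_type mu) -> \bar R) A f.
Definition meas_on (A : set E) (f : E -> R) : Prop :=
  measurable_fun (A : set (caratheodory_type mu)) f.
Definition L2 (A : set E) (f : E -> R) : Prop :=
  meas_on A f /\ (eint A (fun x => (f x ^+ 2)%R) < +oo)%E.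

Definition norm2 (A : set E) (f : E -> R) : R := integ A (fun x => f x ^+ 2).
Definition vnorm2 (A : set E) (v : E -> E) : R :=
  integ A (fun x => dot (v x) (v x)).
End L2.

Definition pderiv (i : 'I_d) (f : E -> R) (x : E) : R :=
  'D_(delta_mx ord0 i) f x.
Definition grad (f : E -> R) (x : E) : E := \row_i pderiv i f x.
Definition diverg (v : E -> E) (x : E) : R :=
  \sum_i pderiv i (fun y => v y ord0 i) x.

Fixpoint Ck (n : nat) (f : E -> R) : Prop :=
  continuous f /\
  if n is n'.+1 then
    forall i : 'I_d, (forall x, derivable f x (delta_mx ord0 i)) /\
                     Ck n' (pderiv i f)
  else True.
Definition smooth (f : E -> R) : Prop := forall n, Ck n f.

Definition test_fun (A : set E) (f : E -> R) : Prop :=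
  smooth f /\ exists K : set E, [/\ compact K, K `<=` A &
                                    forall x, ~ K x -> f x = 0].

Definition weak_grad (A : set E) (v : E -> R) (G : E -> E) : Prop :=
  forall (f : E -> R) (i : 'I_d), test_fun A f ->
    integ vol A (fun x => v x * pderiv i f x) =
    - integ vol A (fun x => G x ord0 i * f x).
Definition weak_div (A : set E) (q : E -> E) (s : E -> R) : Prop :=
  forall f : E -> R, test_fun A f ->
    integ vol A (fun x => dot (q x) (grad f x)) =
    - integ vol A (fun x => s x * f x).

Definition H1 (A : set E) (v : E -> R) (G : E -> E) : Prop :=
  [/\ L2 vol A v, forall i, L2 vol A (fun x => G x ord0 i) & weak_grad A v G].

(* [g] is the limit in [L2 (bd A)] of the boundary values of smooth functions
   converging to [v] in [H1 A]. *)
Definition is_trace (A : set E) (v g : E -> R) : Prop :=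
  L2 sur (bd A) g /\
  exists G : E -> E, H1 A v G /\
  exists V : nat -> E -> R,
    [/\ forall n, smooth (V n),
        (fun n => eint vol A (fun x => (V n x - v x) ^+ 2)) @ \oo --> 0%E,
        (fun n => eint vol A (fun x =>
           dot (grad (V n) x - G x) (grad (V n) x - G x))) @ \oo --> 0%E &
        (fun n => eint sur (bd A) (fun x => (V n x - g x) ^+ 2)) @ \oo --> 0%E].

(* [q + kappa grad u = 0] and [div q = f] in [A], [u = g] on the boundary. *)
Definition mixed_solution (A : set E) (kappa : E -> R) (q : E -> E)
    (u f g : E -> R) : Prop :=
  [/\ exists G : E -> E, H1 A u G /\
        {ae (vol : set (caratheodory_type vol) -> \bar R),
          forall x, A x -> q x + kappa x *: G x = 0},
      weak_div A q f &
      is_trace A u g].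

Definition regularity (A : set E) (kappa : E -> R) (Creg : R) : Prop :=
  forall (Theta : E -> R) (phi : E -> E) (psi : E -> R),
    L2 vol A Theta -> mixed_solution A kappa phi psi Theta (fun=> 0) ->
    exists (Gphi : 'I_d -> E -> E) (Gpsi : E -> E) (Hpsi : 'I_d -> E -> E),
      [/\ forall i, H1 A (fun x => phi x ord0 i) (Gphi i),
          H1 A psi Gpsi,
          forall i, H1 A (fun x => Gpsi x ord0 i) (Hpsi i) &
          Num.sqrt (vnorm2 vol A phi + \sum_i vnorm2 vol A (Gphi i)) +
          Num.sqrt (norm2 vol A psi + vnorm2 vol A Gpsi +
                    \sum_i vnorm2 vol A (Hpsi i))
          <= Creg * Num.sqrt (norm2 vol A Theta)].

(* The source term is an operator on functions. *)
Definition lipschitz_L2 (A : set E) (F : (E -> R) -> E -> R) (L : R) : Prop :=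
  0 <= L /\ forall v w, L2 vol A v -> L2 vol A w ->
    L2 vol A (F v) /\
    Num.sqrt (norm2 vol A (fun x => F v x - F w x))
    <= L * Num.sqrt (norm2 vol A (fun x => v x - w x)).

Definition is_poly (k : nat) (f : E -> R) : Prop :=
  exists P : mpoly.mpoly d R,
    (forall m, mpoly.mcoeff m P != 0 -> (mpoly.mdeg m <= k)%N) /\
    forall x, f x = mpoly.meval (fun i => x ord0 i) P.
Definition is_vpoly (k : nat) (v : E -> E) : Prop :=
  forall i, is_poly k (fun x => v x ord0 i).
End sobolev.

(* [B] is a finite union of images of the closed unit cube under smooth
   embeddings, which only meet along the images of the boundary of the cube. *)
Definition piecewise_smooth (R : realType) (d : nat) (B : set 'rV[R]_d) : Prop :=
  let cube := [set y : 'rV[R]_d.-1 | forall i, 0 <= y ord0 i <= 1] in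
  let ocube := [set y : 'rV[R]_d.-1 | forall i, 0 < y ord0 i < 1] in
  exists (m : nat) (G : 'I_m -> 'rV[R]_d.-1 -> 'rV[R]_d),
    [/\ forall j i, smooth (fun y => G j y ord0 i),
        forall j, {in cube &, injective (G j)} /\
                  forall y, cube y -> row_free (jacobian (G j) y),
        B = \bigcup_(j in [set: 'I_m]) (G j @` cube) &
        forall j j', j != j' -> (G j @` ocube) `&` (G j' @` cube) = set0].

(* Elements and faces are represented by their sets of vertices. *)
Record mesh (R : realType) (d : nat) := Mesh {
  nvert : nat;
  vert : 'I_nvert -> 'rV[R]_d;
  elts : {set {set 'I_nvert}} }.

Section mesh_theory.
Context (R : realType) (d : nat) (M : mesh R d).
Local Notation E := 'rV[R]_d.
Local Notation cell := {set 'I_(nvert M)}.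

Definition hull (S : cell) : set E :=
  [set x | exists c : 'I_(nvert M) -> R,
     [/\ forall i, 0 <= c i, forall i, i \notin S -> c i = 0, \sum_i c i = 1 &
         x = \sum_i c i *: vert i]].

Definition affine_indep (S : cell) : Prop :=
  forall c : 'I_(nvert M) -> R, (forall i, i \notin S -> c i = 0) ->
    \sum_i c i = 0 -> \sum_i c i *: vert i = 0 -> forall i, c i = 0.

Definition triangulation : Prop :=
  (forall T, T \in elts M -> #|T| = d.+1 /\ affine_indep T) /\
  (forall T T', T \in elts M -> T' \in elts M ->
     hull T `&` hull T' = hull (T :&: T')%SET).

(* The polyhedral subdomain. *)
Definition Omega_h : set E := (\bigcup_(T in [set T | T \in elts M]) hull T)°.

Definition faces (T : cell) : {set cell} :=
  [set e : cell | (e \subset T) && (#|e| == d)]%SET.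
Definition nbrs (e : cell) : {set cell} := [set T in elts M | e \subset T]%SET.
Definition int_faces : {set cell} :=
  [set e : cell | (#|e| == d) && (#|nbrs e| == 2)]%SET.
Definition bdry_faces : {set cell} :=
  [set e : cell | (#|e| == d) && (#|nbrs e| == 1)]%SET.

(* The two elements sharing an interior face; [elt1 e] is also the element
   having the boundary face [e]. *)
Definition elt1 (e : cell) : cell := nth finset.set0 (enum (nbrs e)) 0.
Definition elt2 (e : cell) : cell := nth finset.set0 (enum (nbrs e)) 1.

Definition hsize (S : cell) : R := ediam (hull S).
Definition mesh_size : R := \big[Num.max/0]_(T in elts M) hsize T.
Definition inball_diam (T : cell) : R :=
  sup [set t | exists (x : E) (r : R), [/\ 0 <= r,
    forall y, enorm (y - x) <= r -> hull T y & t = 2 * r]].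

(* Unit normal to the face [e] of [T], exterior to [T]. *)
Definition outn (T e : cell) : E :=
  xget 0 [set n | [/\ enorm n = 1,
    forall i j, i \in e -> j \in e -> dot n (vert i - vert j) = 0 &
    forall i j, i \in T -> i \notin e -> j \in e ->
      dot n (vert i - vert j) < 0]].

(* Elementwise functions are given by one function (in practice a polynomial,
   also used outside of the element) per element; [broken v] is the resulting
   function on the union of the elements, up to the null set of faces. *)
Definition broken (V : nmodType) (v : cell -> E -> V) (x : E) : V :=
  if [pick T in elts M | `[< hull T x >]] is Some T then v T x else 0.

Definition jump (w : cell -> E -> R) (e : cell) (x : E) : R :=
  w (elt1 e) x - w (elt2 e) x.
Definition njump (v : cell -> E -> E) (e : cell) (x : E) : R :=
  dot (v (elt1 e) x) (outn (elt1 e) e) +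
  dot (v (elt2 e) x) (outn (elt2 e) e).

(* Elementwise L2 projection on polynomials of degree at most [k]. *)
Definition PW (k : nat) (f : E -> R) (T : cell) : E -> R :=
  xget (fun=> 0) [set p : E -> R | is_poly k p /\
    forall w, is_poly k w -> integ (@vol R d) (hull T) (fun x => (f x - p x) * w x) = 0].
End mesh_theory.

(* [xbar e x] is the point of the boundary associated to the point [x] of the
   boundary face [e], [tdir e x] is the unit vector from [x] to [xbar e x];
   [tau T e] is the stabilization function on the face [e] of [T]; [qh], [uh],
   [ustar] are elementwise functions and [uhat] is a facewise function. *)
Record hdg_data (R : realType) (d : nat) (M : mesh R d) := HdgData {
  xbar : {set 'I_(nvert M)} -> 'rV[R]_d -> 'rV[R]_d;
  tdir : {set 'I_(nvert M)} -> 'rV[R]_d -> 'rV[R]_d;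
  tau : {set 'I_(nvert M)} -> {set 'I_(nvert M)} -> 'rV[R]_d -> R;
  qh : {set 'I_(nvert M)} -> 'rV[R]_d -> 'rV[R]_d;
  uh : {set 'I_(nvert M)} -> 'rV[R]_d -> R;
  uhat : {set 'I_(nvert M)} -> 'rV[R]_d -> R;
  ustar : {set 'I_(nvert M)} -> 'rV[R]_d -> R }.

Section transfer.
Context (R : realType) (d : nat) (M : mesh R d) (D : hdg_data M).
Local Notation E := 'rV[R]_d.
Local Notation cell := {set 'I_(nvert M)}.
Local Notation vol := (@vol R d).

Definition tlen (e : cell) (x : E) : R := enorm (x - xbar D e x).
Definition seg (e : cell) (x : E) : set E :=
  [set y | exists s : R, 0 <= s <= tlen e x /\ y = x + s *: tdir D e x].
Definition Text (e : cell) : set E := \bigcup_(x in hull e) seg e x.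

(* The last clause is needed for [kappa] to be defined along the transfer
   segments. *)
Definition transfer (Om : set E) : Prop :=
  (forall e x, e \in bdry_faces M -> hull e x ->
     [/\ bd Om (xbar D e x), enorm (tdir D e x) = 1,
         xbar D e x = x + tlen e x *: tdir D e x,
         seg e x `&` Omega_h M = set0 &
         (forall y, hull e y -> x <> y -> seg e x `&` seg e y = set0)]) /\
  Om `\` closure (Omega_h M) `<=` \bigcup_(e in [set e | e \in bdry_faces M]) Text e /\
  (forall e x s, e \in bdry_faces M -> hull e x ->
     0 < s < tlen e x -> Om (x + s *: tdir D e x)).

(* Largest distance of a point of [A] to the hyperplane containing the
   boundary face [e]. *)
Definition height (e : cell) (A : set E) : R :=
  sup [set r | exists y z, [/\ A y, hull e z &
                               r = `|dot (y - z) (outn (elt1 e) e)|]].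
Definition hperp (e : cell) : R := height e (hull (elt1 e)).
Definition Hperp (e : cell) : R := height e (Text e).
Definition patch_ratio (e : cell) : R := Hperp e / hperp e.

Definition ncomp (e : cell) (chi : E -> E) (x : E) : R :=
  dot (chi x) (outn (elt1 e) e).
Definition Vk (k : nat) (e : cell) : set (E -> E) :=
  [set chi | is_vpoly k chi /\
     exists2 x, (Text e `|` hull (elt1 e)) x & ncomp e chi x != 0].

(* When [patch_ratio e = 0] the patch is a null set and [Cext k e = 0]. *)
Definition Cext (k : nat) (e : cell) : R :=
  (Num.sqrt (patch_ratio e))^-1 *
  sup [set Num.sqrt (norm2 vol (Text e) (ncomp e chi)) /
           Num.sqrt (norm2 vol (hull (elt1 e)) (ncomp e chi)) | chi in Vk k e].
(* As the normal is constant, the contraction of the gradient of [chi] with it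
   is the gradient of the normal component of [chi]. *)
Definition Cinv (k : nat) (e : cell) : R :=
  hperp e *
  sup [set Num.sqrt (vnorm2 vol (hull (elt1 e)) (grad (ncomp e chi))) /
           Num.sqrt (norm2 vol (hull (elt1 e)) (ncomp e chi)) | chi in Vk k e].

Definition max_patch (k : nat) : R :=
  \big[Num.max/0]_(e in bdry_faces M)
     Num.max (patch_ratio e ^+ 2) (patch_ratio e * Cext k e ^+ 2).
End transfer.

Section hdg.
Context (R : realType) (d : nat) (M : mesh R d) (D : hdg_data M).
Local Notation E := 'rV[R]_d.
Local Notation cell := {set 'I_(nvert M)}.
Local Notation vol := (@vol R d).
Local Notation sur := (@sur R d).
Variables (kappa g : E -> R) (F : (E -> R) -> E -> R) (k : nat).

Definition is_stab (taumax : R) : Prop :=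
  (forall T e, T \in elts M -> e \in faces T -> meas_on sur (hull e) (tau D T e)) /\
  (forall T e x, T \in elts M -> e \in faces T -> hull e x ->
     0 < tau D T e x <= taumax) /\
  (exists T e x, [/\ T \in elts M, e \in faces T, hull e x &
     tau D T e x = taumax]).

Definition phih (e : cell) (x : E) : R :=
  g (xbar D e x) +
  Rintegral lebesgue_measure `[0, tlen D e x] (fun s : R =>
    (kappa (x + s *: tdir D e x))^-1 *
    dot (qh D (elt1 e) (x + s *: tdir D e x)) (tdir D e x)).

(* Normal component of the numerical flux on the face [e] of [T]. *)
Definition flux (T e : cell) (x : E) : R :=
  dot (qh D T x) (outn T e) + tau D T e x * (uh D T x - uhat D e x).

Definition bdry_sum (f : cell -> cell -> E -> R) : R :=
  \sum_(T in elts M) \sum_(e in faces T) integ sur (hull e) (f T e).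

Definition hdg_solution : Prop :=
  [/\ forall T, T \in elts M -> is_vpoly k (qh D T) /\ is_poly k (uh D T),
      forall T e, T \in elts M -> e \in faces T -> is_poly k (uhat D e),
      forall e, e \in bdry_faces M -> L2 sur (hull e) (phih e) &
  forall (v : cell -> E -> E) (w mu : cell -> E -> R),
    (forall T, T \in elts M -> is_vpoly k (v T) /\ is_poly k (w T)) ->
    (forall T e, T \in elts M -> e \in faces T -> is_poly k (mu e)) ->
    [/\ \sum_(T in elts M)
          integ vol (hull T) (fun x => (kappa x)^-1 * dot (qh D T x) (v T x))
        - \sum_(T in elts M)
          integ vol (hull T) (fun x => uh D T x * diverg (v T) x)
        + bdry_sum (fun T e x => uhat D e x * dot (v T x) (outn T e)) = 0,
        - \sum_(T in elts M)
          integ vol (hull T) (fun x => dot (qh D T x) (grad (w T) x))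
        + bdry_sum (fun T e x => flux T e x * w T x)
        = \sum_(T in elts M)
          integ vol (hull T) (fun x => F (broken (uh D)) x * w T x),
        \sum_(e in bdry_faces M) integ sur (hull e) (fun x => uhat D e x * mu e x)
        = \sum_(e in bdry_faces M) integ sur (hull e) (fun x => phih e x * mu e x) &
        \sum_(T in elts M) \sum_(e in faces T | e \notin bdry_faces M)
          integ sur (hull e) (fun x => flux T e x * mu e x) = 0]].

Definition postprocessing : Prop :=
  forall T, T \in elts M ->
  [/\ is_poly k.+1 (ustar D T),
      forall w, is_poly k.+1 w ->
        integ vol (hull T) (fun x => kappa x * dot (grad (ustar D T) x) (grad w x))
        + integ vol (hull T) (fun x => F (broken (ustar D)) x * w x)
        = - integ vol (hull T) (fun x => dot (qh D T x) (grad w x))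
        + integ vol (hull T) (fun x => F (broken (uh D)) x * w x) &
      forall w, is_poly 0 w ->
        integ vol (hull T) (fun x => ustar D T x * w x)
        = integ vol (hull T) (fun x => uh D T x * w x)].

Definition Fstar : E -> R := F (broken (ustar D)).

Definition osc2 : R :=
  \sum_(T in elts M) hsize T ^+ 2 *
    norm2 vol (hull T) (fun x => Fstar x - PW k Fstar T x).

Definition res2 (T : cell) : R :=
  hsize T ^+ 2 *
    norm2 vol (hull T) (fun x => PW k Fstar T x - diverg (qh D T) x).
Definition gap2 (T : cell) : R :=
  vnorm2 vol (hull T) (fun x =>
    Num.sqrt (kappa x) *: grad (ustar D T) x
    + (Num.sqrt (kappa x))^-1 *: qh D T x).
Definition qjump2 (e : cell) : R :=
  hsize e * norm2 sur (hull e) (njump (qh D) e).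
Definition ujump2 (e : cell) : R :=
  (hsize e)^-1 * norm2 sur (hull e) (jump (ustar D) e).
Definition bmis2 (e : cell) : R :=
  (hsize e)^-1 * norm2 sur (hull e) (fun x => phih e x - ustar D (elt1 e) x).

Definition eta2 : R :=
  \sum_(T in elts M)
    (res2 T + gap2 T
     + \sum_(e in faces T | e \in int_faces M) (qjump2 e + ujump2 e)
     + \sum_(e in faces T | e \in bdry_faces M) bmis2 e).

Variables (q : E -> E) (u phi : E -> R).

Definition qerr2 : R :=
  vnorm2 vol (Omega_h M)
    (fun x => (Num.sqrt (kappa x))^-1 *: (q x - broken (qh D) x)).
Definition uerr2 : R :=
  norm2 vol (Omega_h M) (fun x => u x - broken (ustar D) x).
Definition phierr2 : R :=
  \sum_(e in bdry_faces M)
    (hsize e)^-1 * norm2 sur (hull e) (fun x => phi x - phih e x).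
Definition err2 : R := qerr2 + uerr2 + phierr2.

Definition estimate1 (L C : R) : Prop :=
  qerr2 <=
    C * (osc2 + \sum_(T in elts M) res2 T + \sum_(T in elts M) gap2 T
         + \sum_(e in int_faces M) (qjump2 e + ujump2 e)
         + \sum_(e in bdry_faces M) bmis2 e)
    + C * phierr2 + C * L * uerr2.
Definition estimate2 (C : R) : Prop :=
  uerr2 <=
    C * (\sum_(T in elts M) gap2 T + \sum_(e in int_faces M) ujump2 e
         + \sum_(e in bdry_faces M) bmis2 e + qerr2 + phierr2).
Definition estimate3 (L C : R) : Prop :=
  phierr2 <=
    C * max_patch D k *
    (qerr2 + mesh_size M ^+ 2 * L ^+ 2 * uerr2
     + \sum_(T in elts M) res2 T + osc2).
End hdg.

(* Main.v *)
Require Import Defs.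
From mathcomp Require Import all_boot all_order all_algebra.
From mathcomp Require Import all_classical all_reals all_analysis.
From mathcomp Require Import ring lra.

Import Order.TTheory GRing.Theory Num.Theory.
Import numFieldNormedType.Exports.
Local Open Scope classical_set_scope.
Local Open Scope ring_scope.

(** Write [Q], [U], [P] for the squared errors of the flux, of the postprocessed
potential and of the boundary data, and [E] for [eta2 + osc2].  The three
estimates bound each error by [E] plus multiples of the other two, and the
smallness assumptions say that these feedback terms can be absorbed, always
with a margin that does not depend on the mesh:
- inserting the bound of [P] into that of [Q] creates a term [C1 * a * Q], where
  [a = C3 * max_patch]; as [C1 * a < 1/2] it goes to the left, and [Q] is
  bounded by [E] and [U] with the coefficient [b = L (L h^2 + 2 C1)] of [U];
- inserting this into the bound of [U] creates [C2 * b * U <= U / 2], so [U] is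
  bounded by [E] and [2 * C2 * P];
- coming back to [P], whose bound contains [Q] and [h^2 L^2 U], the coefficient
  of [P] on the right is at most [2 * a], and [(2 * C2 + 1) * a < 1/2] makes
  [1 - 2 * a] at least [2 * C2 / (2 * C2 + 1)].

Hence [P], then [U], then [Q] are bounded by multiples of [E] that depend on
[C1] and [C2] only.  This is [absorb_errors].

The face terms of the estimates are summed once per face, those of [eta2] once
per element and face.  Since every face belongs to an element and all terms are
nonnegative, the former sums are at most the latter ([sum_faces_le]). *)

(** * Absorption of the error terms *)

(** Everything is affine in [Q], [U], [P], [E] except for the products with [a],
[L] and [h]; these occur only in the three combinations that the smallness
assumptions control, and once they are replaced by their bounds the errors
solve a linear system whose loop gains are below 1.  For the scheme,
[a = C3 * max_patch] and [E] collects all the estimator terms. *)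
Lemma absorb_errors (R : realFieldType) (C1 C2 a L h E Q U P : R) :
  0 < C1 -> 0 < C2 -> 0 <= a -> 0 <= L -> 0 <= E -> 0 <= Q -> 0 <= U -> 0 <= P ->
  Q <= C1 * E + C1 * P + C1 * L * U ->
  U <= C2 * (E + Q + P) ->
  P <= a * (Q + h ^+ 2 * L ^+ 2 * U + E) ->
  C1 * a < 1 / 2 -> C2 * L * (L * h ^+ 2 + 2 * C1) < 1 / 2 ->
  (2 * C2 + 1) * a < 1 / 2 ->
  Q + U + P <= (C1 + 1) * ((C2 + 1) * (4 * C2 + 3) / C2) * E.
Proof.
move=> C1_gt0 C2_gt0 a_ge0 L_ge0 E_ge0 Q_ge0 U_ge0 P_ge0 estQ estU estP.
move=> small1 small2 small3.
set w := h ^+ 2 * L ^+ 2 * U; set v := C1 * L * U.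
have w_ge0 : 0 <= w by rewrite mulr_ge0// mulr_ge0 ?sqr_ge0.
have v_ge0 : 0 <= v by rewrite mulr_ge0// mulr_ge0// ltW.
have absorbQ : Q <= (2 * C1 + 1) * E + (w + 2 * v).
  have C1P : C1 * P <= C1 * a * (Q + w + E).
    by rewrite -mulrA ler_wpM2l ?(ltW C1_gt0).
  have half : C1 * a * (Q + w + E) <= 1 / 2 * (Q + w + E).
    by rewrite ler_wpM2r ?(ltW small1)// !addr_ge0.
  by rewrite -/v in estQ; lra.
have feedback : C2 * (w + 2 * v) <= U / 2.
  have -> : C2 * (w + 2 * v) = C2 * L * (L * h ^+ 2 + 2 * C1) * U.
    by rewrite /w /v; ring.
  by have := ler_wpM2r U_ge0 (ltW small2); lra.
have C2Q : C2 * Q <= C2 * ((2 * C1 + 1) * E) + U / 2.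
  by have := ler_wpM2l (ltW C2_gt0) absorbQ; rewrite mulrDr; lra.
have absorbU : U <= 4 * C2 * (C1 + 1) * E + 2 * C2 * P.
  by lra.
have C2w : C2 * w <= U / 2.
  have : 0 <= C2 * v by rewrite mulr_ge0// ltW.
  by lra.
(* The term [2 * P] comes from [Q + w <= (2 * C1 + 1) * E + U / C2], where the
   bound of [U] contains [2 * C2 * P]. *)
have loopP : P <= a * (6 * (C1 + 1) * E + 2 * P).
  apply: (le_trans estP); rewrite -/w ler_wpM2l// -(ler_pM2l C2_gt0).
  by lra.
have boundP : 2 * C2 * P <= 3 * (C1 + 1) * E.
  have aE : (2 * C2 + 1) * (a * (6 * (C1 + 1) * E + 2 * P))
      <= 1 / 2 * (6 * (C1 + 1) * E + 2 * P).
    rewrite mulrA ler_wpM2r ?(ltW small3)// addr_ge0 ?mulr_ge0//.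
    by lra.
  have D_ge0 : 0 <= 2 * C2 + 1 by lra.
  have := ler_wpM2l D_ge0 loopP.
  by lra.
have boundU : U <= (C1 + 1) * (4 * C2 + 3) * E by lra.
(* Multiplying by [C2] clears the denominator of the constant, and [C2 * Q] is
   what [C2Q] controls. *)
rewrite -(ler_pM2l C2_gt0).
have -> : C2 * ((C1 + 1) * ((C2 + 1) * (4 * C2 + 3) / C2) * E)
    = (C1 + 1) * ((C2 + 1) * (4 * C2 + 3)) * E.
  by field; rewrite gt_eqF.
have C2U := ler_wpM2l (ltW C2_gt0) boundU.
have C2E : 0 <= C2 * E by rewrite mulr_ge0// ltW.
by lra.
Qed.

(** * Signs of the estimator and error terms *)

Lemma sup_ge0 (R : realType) (A : set R) : (forall x, A x -> 0 <= x) -> 0 <= sup A.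
Proof.
move=> A_ge0; have [[[x Ax] ubA]|noSup] := pselect (has_sup A).
  exact: le_trans (A_ge0 x Ax) (ub_le_sup ubA Ax).
(* An empty or unbounded set has supremum 0 by convention. *)
by rewrite sup_out.
Qed.

Section signs.
Context (R : realType) (d : nat).
Local Notation E := 'rV[R]_d.
Implicit Types (mu : {outer_measure set E -> \bar R}) (A : set E).

Lemma dot_ge0 (x : E) : 0 <= dot x x.
Proof. by apply: sumr_ge0 => i _; rewrite -expr2 sqr_ge0. Qed.

Lemma integ_ge0 mu A (f : E -> R) : (forall x, 0 <= f x) -> 0 <= integ mu A f.
Proof.
by move=> f_ge0; apply: fine_ge0; apply: integral_ge0 => x _; rewrite lee_fin.
Qed.

Lemma norm2_ge0 mu A (f : E -> R) : 0 <= norm2 mu A f.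
Proof. by apply: integ_ge0 => x; exact: sqr_ge0. Qed.

Lemma vnorm2_ge0 mu A (v : E -> E) : 0 <= vnorm2 mu A v.
Proof. by apply: integ_ge0 => x; exact: dot_ge0. Qed.

Lemma hsize_ge0 (M : mesh R d) (S : {set 'I_(nvert M)}) : 0 <= hsize S.
Proof. by apply: sup_ge0 => _ [x [y [_ _ ->]]]; exact: sqrtr_ge0. Qed.

Lemma max_patch_ge0 (M : mesh R d) (D : hdg_data M) k : 0 <= max_patch D k.
Proof.
rewrite /max_patch; elim/big_rec: _ => // e x _ x_ge0.
by rewrite le_max x_ge0 orbT.
Qed.

End signs.

(** * Sums over faces *)

(** After exchanging the two sums, each face is counted once for every element
that has it, and one such element is enough. *)
Lemma sum_faces_le (R : realType) (d : nat) (M : mesh R d)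
    (B : {set {set 'I_(nvert M)}}) (f : {set 'I_(nvert M)} -> R) :
  (forall e, e \in B -> #|e| = d /\ (0 < #|nbrs e|)%N) ->
  (forall e, 0 <= f e) ->
  \sum_(e in B) f e <= \sum_(T in elts M) \sum_(e in faces T | e \in B) f e.
Proof.
move=> Bface f_ge0.
rewrite (exchange_big_dep (mem B)) /=; last by move=> T e _ /andP[].
apply: ler_sum => e eB; have [card_e /card_gt0P[T]] := Bface e eB.
rewrite inE => /andP[TM eT].
rewrite (bigD1 T) /=; last by rewrite TM eB inE eT card_e eqxx.
by rewrite lerDl sumr_ge0.
Qed.

Section reliability.
Context (R : realType) (d : nat) (M : mesh R d) (D : hdg_data M).
Variables (kappa g : 'rV[R]_d -> R) (F : ('rV[R]_d -> R) -> 'rV[R]_d -> R).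
Variable k : nat.

Lemma sum_estimator_le :
  \sum_(T in elts M) res2 D F k T + \sum_(T in elts M) gap2 D kappa T
  + \sum_(e in int_faces M) (qjump2 D e + ujump2 D e)
  + \sum_(e in bdry_faces M) bmis2 D kappa g e
  <= eta2 D kappa g F k.
Proof.
rewrite /eta2 [leRHS]big_split /= lerD//; last first.
  apply: sum_faces_le => [e|e]; first by rewrite inE => /andP[/eqP-> /eqP->].
  by rewrite mulr_ge0 ?invr_ge0 ?hsize_ge0 ?norm2_ge0.
rewrite [leRHS]big_split /= lerD//; first by rewrite big_split.
apply: sum_faces_le => [e|e]; first by rewrite inE => /andP[/eqP-> /eqP->].
by rewrite addr_ge0// mulr_ge0 ?invr_ge0 ?hsize_ge0 ?norm2_ge0.
Qed.

Variables (q : 'rV[R]_d -> 'rV[R]_d) (u phi : 'rV[R]_d -> R).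

(** The estimate on a single mesh: the coefficient does not involve [M] or [D],
which makes it uniform along a family of meshes. *)
Lemma reliability_one_mesh (L C1 C2 C3 : R) :
  0 <= L -> 0 < C1 -> 0 < C2 -> 0 < C3 ->
  estimate1 D kappa g F k q u phi L C1 ->
  estimate2 D kappa g q u phi C2 ->
  estimate3 D kappa g F k q u phi L C3 ->
  C1 * C3 * max_patch D k < 1 / 2 ->
  C2 * L * (L * mesh_size M ^+ 2 + 2 * C1) < 1 / 2 ->
  (2 * C2 + 1) * C3 * max_patch D k < 1 / 2 ->
  err2 D kappa g q u phi
  <= (C1 + 1) * ((C2 + 1) * (4 * C2 + 3) / C2)
     * (eta2 D kappa g F k + osc2 D F k).
Proof.
move=> L_ge0 C1_gt0 C2_gt0 C3_gt0 est1 est2 est3 small1 small2 small3.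
have estimator_le := sum_estimator_le.
have osc_ge0 : 0 <= osc2 D F k.
  by apply: sumr_ge0 => T _; rewrite mulr_ge0 ?exprn_ge0 ?norm2_ge0 ?hsize_ge0.
have res_ge0 : 0 <= \sum_(T in elts M) res2 D F k T.
  by apply: sumr_ge0 => T _; rewrite mulr_ge0 ?exprn_ge0 ?norm2_ge0 ?hsize_ge0.
have gap_ge0 : 0 <= \sum_(T in elts M) gap2 D kappa T.
  by apply: sumr_ge0 => T _; exact: vnorm2_ge0.
have qjump_ge0 : 0 <= \sum_(e in int_faces M) qjump2 D e.
  by apply: sumr_ge0 => e _; rewrite mulr_ge0 ?hsize_ge0 ?norm2_ge0.
have ujump_ge0 : 0 <= \sum_(e in int_faces M) ujump2 D e.
  by apply: sumr_ge0 => e _; rewrite mulr_ge0 ?invr_ge0 ?hsize_ge0 ?norm2_ge0.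
have bmis_ge0 : 0 <= \sum_(e in bdry_faces M) bmis2 D kappa g e.
  by apply: sumr_ge0 => e _; rewrite mulr_ge0 ?invr_ge0 ?hsize_ge0 ?norm2_ge0.
have P_ge0 : 0 <= phierr2 D kappa g phi.
  by apply: sumr_ge0 => e _; rewrite mulr_ge0 ?invr_ge0 ?hsize_ge0 ?norm2_ge0.
have Q_ge0 : 0 <= qerr2 D kappa q by exact: vnorm2_ge0.
have U_ge0 : 0 <= uerr2 D u by exact: norm2_ge0.
have a_ge0 : 0 <= C3 * max_patch D k.
  by rewrite mulr_ge0 ?max_patch_ge0// ltW.
rewrite /estimate1 in est1; rewrite /estimate2 in est2; rewrite /estimate3 in est3.
have jumpE : \sum_(e in int_faces M) (qjump2 D e + ujump2 D e)
    = \sum_(e in int_faces M) qjump2 D e + \sum_(e in int_faces M) ujump2 D e.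
  by rewrite big_split.
rewrite jumpE in estimator_le est1.
apply: (@absorb_errors _ C1 C2 (C3 * max_patch D k) L (mesh_size M)) => //.
- by lra.
- apply: (le_trans est1); rewrite !lerD2r ler_wpM2l ?(ltW C1_gt0)//.
  by lra.
- apply: (le_trans est2); rewrite ler_wpM2l ?(ltW C2_gt0)//.
  by lra.
- apply: (le_trans est3); rewrite ler_wpM2l//.
  by lra.
- by rewrite mulrA.
- by rewrite mulrA.
Qed.

End reliability.

(** * The reliability estimate *)

Theorem theorem3 (R : realType) (d : nat) (Hd : (d = 2 \/ d = 3)%N)
  (* domain, coefficient, data and source term *)
  (Om : set 'rV[R]_d) (HOm : is_domain Om) (HOmb : bounded_set Om)
  (HGamma : piecewise_smooth (bd Om))
  (kappa : 'rV[R]_d -> R) (klo khi : R)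
  (Hkm : meas_on (@vol R d) Om kappa) (Hklo : 0 < klo)
  (Hkappa : forall x, Om x -> klo <= kappa x <= khi)
  (g : 'rV[R]_d -> R)
  (F : ('rV[R]_d -> R) -> 'rV[R]_d -> R) (LOm : R) (HF : lipschitz_L2 Om F LOm)
  (* exact solution *)
  (q : 'rV[R]_d -> 'rV[R]_d) (u : 'rV[R]_d -> R)
  (Hqu : mixed_solution Om kappa q u (F u) g)
  (Hreg : exists Creg : R, regularity Om kappa Creg)
  (* family of meshes and of discrete solutions *)
  (k : nat) (Hk : (1 <= k)%N)
  (I : Type) (M : I -> mesh R d) (D : forall i, hdg_data (M i))
  (L taumax : I -> R) (phi : I -> 'rV[R]_d -> R)
  (HM : forall i, triangulation (M i))
  (Hdom : forall i, is_domain (Omega_h (M i)))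
  (HdomOm : forall i, Omega_h (M i) `<=` Om)
  (Hsize : forall i, mesh_size (M i) < 1)
  (Hshape : exists sigma : R, forall i T, T \in elts (M i) ->
     hsize T <= sigma * inball_diam T)
  (HL : forall i, lipschitz_L2 (Omega_h (M i)) F (L i) /\ L i <= LOm)
  (Hphi : forall i, is_trace (Omega_h (M i)) u (phi i))
  (Htransfer : forall i, transfer (D i) Om)
  (Htau : forall i, is_stab (D i) (taumax i))
  (Hhdg : forall i, hdg_solution (D i) kappa g F k)
  (Hpost : forall i, postprocessing (D i) kappa F k)
  (* standing assumptions *)
  (Htn : forall i e x, e \in bdry_faces (M i) -> hull e x ->
     tdir (D i) e x = outn (elt1 e) e)
  (Hratio : exists C : R, forall i e, e \in bdry_faces (M i) ->
     patch_ratio (D i) e <= C)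
  (HtauH : forall i e, e \in bdry_faces (M i) ->
     taumax i * Hperp (D i) e * klo^-1 <= 1 / 3)
  (Hpatch : forall i e, e \in bdry_faces (M i) ->
     khi * klo^-1 * patch_ratio (D i) e ^+ 3 * (Cext (D i) k e * Cinv (D i) k e) ^+ 2
     <= 1)
  (HphiW : forall i, exists w : {set 'I_(nvert (M i))} -> 'rV[R]_d -> R,
     (forall T, T \in elts (M i) -> is_poly k.+1 (w T)) /\
     is_trace (Omega_h (M i)) (broken w) (phi i))
  (* the three estimates *)
  (C1 C2 C3 : R) (HC1 : 0 < C1) (HC2 : 0 < C2) (HC3 : 0 < C3)
  (Hest1 : forall i, estimate1 (D i) kappa g F k q u (phi i) (L i) C1)
  (Hest2 : forall i, estimate2 (D i) kappa g q u (phi i) C2)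
  (Hest3 : forall i, estimate3 (D i) kappa g F k q u (phi i) (L i) C3)
  (Hsmall1 : forall i, C1 * C3 * max_patch (D i) k < 1 / 2)
  (Hsmall2 : forall i,
     C2 * L i * (L i * mesh_size (M i) ^+ 2 + 2 * C1) < 1 / 2)
  (Hsmall3 : forall i, (2 * C2 + 1) * C3 * max_patch (D i) k < 1 / 2) :
  exists Crel : R, 0 < Crel /\
    forall i, err2 (D i) kappa g q u (phi i)
              <= Crel * (eta2 (D i) kappa g F k + osc2 (D i) F k).
Proof.
exists ((C1 + 1) * ((C2 + 1) * (4 * C2 + 3) / C2)); split.
  by rewrite mulr_gt0 ?addr_gt0 ?divr_gt0 ?mulr_gt0 ?addr_gt0 ?mulr_gt0.
move=> i; have [[L_ge0 _] _] := HL i.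
exact: reliability_one_mesh L_ge0 HC1 HC2 HC3 (Hest1 i) (Hest2 i) (Hest3 i)
  (Hsmall1 i) (Hsmall2 i) (Hsmall3 i).
Qed.
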